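(* Let $\mathsf{CL}_{\rm b}:=\mathsf{ILL}_\bot+\mathsf{PRO}+\mathsf{DNE}$ and let $A\mapsto A^\dagger$ be the translation of formulas of first-order classical logic $\mathsf{CL}$ into formulas of $\mathsf{ILL}_\bot$ defined in the context. Then for every formula $A$ of $\mathsf{CL}$: $\vdash_{\mathsf{CL}}A$ if and only if $\vdash_{\mathsf{CL}_{\rm b}}A^\dagger$.
   Context: Intuitionistic linear logic $\mathsf{ILL}$ (first order). Formulas are built from atomic formulas, including the constants $1,\top,0$, using $\otimes,\&,\oplus,\multimap$, $\forall x,\exists x$ and $!$. Sequents are $\Gamma\vdash A$ with $\Gamma$ a finite multiset of formulas and exactly one formula on the right. Axioms: $A\vdash A$; $\vdash 1$; $\Gamma\vdash\top$; $\Gamma,0\vdash C$. Rules (premises $\Rightarrow$ conclusion): (cut) $\Gamma\vdash A;\ \Delta,A\vdash C\Rightarrow\Gamma,\Delta\vdash C$; $\Gamma\vdash C\Rightarrow\Gamma,1\vdash C$; $\Gamma\vdash A;\ \Delta\vdash B\Rightarrow\Gamma,\Delta\vdash A\otimes B$; $\Gamma,A,B\vdash C\Rightarrow\Gamma,A\otimes B\vdash C$; $\Gamma,A\vdash B\Rightarrow\Gamma\vdash A\multimap B$; $\Gamma\vdash A;\ \Delta,B\vdash C\Rightarrow\Gamma,\Delta,A\multimap B\vdash C$; $\Gamma\vdash A;\ \Gamma\vdash B\Rightarrow\Gamma\vdash A\& B$; $\Gamma,A\vdash C\Rightarrow\Gamma,A\& B\vdash C$; $\Gamma,B\vdash C\Rightarrow\Gamma,A\&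 B\vdash C$; $\Gamma\vdash A\Rightarrow\Gamma\vdash A\oplus B$; $\Gamma\vdash B\Rightarrow\Gamma\vdash A\oplus B$; $\Gamma,A\vdash C;\ \Gamma,B\vdash C\Rightarrow\Gamma,A\oplus B\vdash C$; $\Gamma\vdash A\Rightarrow\Gamma\vdash\forall xA$; $\Gamma,A[t/x]\vdash C\Rightarrow\Gamma,\forall xA\vdash C$; $\Gamma\vdash A[t/x]\Rightarrow\Gamma\vdash\exists xA$; $\Gamma,A\vdash C\Rightarrow\Gamma,\exists xA\vdash C$ (usual eigenvariable conditions); $\Gamma,!A,!A\vdash C\Rightarrow\Gamma,!A\vdash C$; $\Gamma\vdash C\Rightarrow\Gamma,!A\vdash C$; $!\Gamma\vdash A\Rightarrow\,!\Gamma\vdash\,!A$; $\Gamma,A\vdash C\Rightarrow\Gamma,!A\vdash C$. $\mathsf{ILL}_\bot$ extends $\mathsf{ILL}$ by one more constant $\bot$ (also counted as atomic); its sequents have at most one formula on the right (so $C$ in the rules above may be absent), and it has the additional axiom $\bot\vdash$ and rule $\Gamma\vdash\ \Rightarrow\Gamma\vdash\bot$. Negation is $\neg A:=A\multimap\bot$. $\mathsf{PRO}$ is the axiom schema $A\vdash\,!A$ and $\mathsf{DNE}$ the axiom schema $\neg\neg A\vdash A$. $\vdash_S A$ means that the sequent $\vdash A$ is derivable in $S$. $\mathsf{CL}$ is standard first-order classical logic with $\wedge,\vee,\to,\bot,\forall,\exists$. The translation $(\cdot)^\dagger$: $P^\dagger:=P$ for $P$ atomic other than $\bot$; $\bot^\dagger:=\bot$;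 $(A\wedge B)^\dagger:=A^\dagger\& B^\dagger$; $(A\vee B)^\dagger:=A^\dagger\oplus B^\dagger$; $(A\to B)^\dagger:=A^\dagger\multimap B^\dagger$; $(\forall xA)^\dagger:=\forall xA^\dagger$; $(\exists xA)^\dagger:=\exists xA^\dagger$. *)

(* Defs.v *)
(* Stdlib only.  First-order syntax over an arbitrary signature, in de Bruijn
   style: a quantifier binds index 0 of its body, and formulas are thereby taken
   up to renaming of bound variables.  Free variables are the remaining indices,
   so formulas need not be closed. *)
From Stdlib Require Import List Permutation.
From Stdlib Require Vector.
Import ListNotations.

Record signature : Type := Signature {
  fsym : Type;
  farity : fsym -> nat;
  psym : Type;
  parity : psym -> nat
}.

Inductive term (S : signature) : Type :=
| var (n : nat)
| app (f : fsym S) (args : Vector.t (term S) (farity S f)).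

Arguments var {S} n.
Arguments app {S} f args.

Fixpoint subst_term {S : signature} (s : nat -> term S) (t : term S) : term S :=
  match t with
  | var n => s n
  | app f args => app f (Vector.map (subst_term s) args)
  end.

Definition shift {S : signature} (n : nat) : term S := var (Datatypes.S n).

Definition inst {S : signature} (t : term S) (n : nat) : term S :=
  match n with
  | 0 => t
  | Datatypes.S m => var m
  end.

(* The substitution [s], carried under one binder. *)
Definition up {S : signature} (s : nat -> term S) (n : nat) : term S :=
  match n with
  | 0 => var 0
  | Datatypes.S m => subst_term shift (s m)
  end.

(** ** Intuitionistic linear logic with [bot] *)

Inductive lform (S : signature) : Type :=
| LAtom (P : psym S) (args : Vector.t (term S) (parity S P))
| LOne
| LTop
| LZero
| LBot
| LTensor (A B : lform S)
| LWith (A B : lform S)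
| LPlus (A B : lform S)
| LImp (A B : lform S)
| LAll (A : lform S)
| LEx (A : lform S)
| LBang (A : lform S).

Arguments LAtom {S} P args.
Arguments LOne {S}.
Arguments LTop {S}.
Arguments LZero {S}.
Arguments LBot {S}.
Arguments LTensor {S} A B.
Arguments LWith {S} A B.
Arguments LPlus {S} A B.
Arguments LImp {S} A B.
Arguments LAll {S} A.
Arguments LEx {S} A.
Arguments LBang {S} A.

Definition LNot {S : signature} (A : lform S) : lform S := LImp A LBot.

Fixpoint lsubst {S : signature} (s : nat -> term S) (A : lform S) : lform S :=
  match A with
  | LAtom P args => LAtom P (Vector.map (subst_term s) args)
  | LOne => LOne
  | LTop => LTop
  | LZero => LZero
  | LBot => LBot
  | LTensor A B => LTensor (lsubst s A) (lsubst s B)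
  | LWith A B => LWith (lsubst s A) (lsubst s B)
  | LPlus A B => LPlus (lsubst s A) (lsubst s B)
  | LImp A B => LImp (lsubst s A) (lsubst s B)
  | LAll A => LAll (lsubst (up s) A)
  | LEx A => LEx (lsubst (up s) A)
  | LBang A => LBang (lsubst s A)
  end.

(* [ILLbot Ax G C]: the sequent with antecedent [G] and succedent [C] is
   derivable in ILL with bot, extended by the sequents of [Ax] as extra axioms.
   Antecedents are multisets: lists with the rule [ill_exch].  The succedent is
   [Some C], or [None] when it is empty; a variable [C : option _] ranges over
   both.  The eigenvariable condition is expressed by shifting the side formulas
   in [ill_allR] and [ill_exL], which makes index 0 fresh for them. *)
Inductive ILLbot {S : signature} (Ax : list (lform S) -> option (lform S) -> Prop) :
  list (lform S) -> option (lform S) -> Prop :=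
| ill_extra G C : Ax G C -> ILLbot Ax G C
| ill_exch G D C : Permutation G D -> ILLbot Ax G C -> ILLbot Ax D C
| ill_id A : ILLbot Ax [A] (Some A)
| ill_cut G D A C :
    ILLbot Ax G (Some A) -> ILLbot Ax (A :: D) C -> ILLbot Ax (G ++ D) C
| ill_oneR : ILLbot Ax [] (Some LOne)
| ill_oneL G C : ILLbot Ax G C -> ILLbot Ax (LOne :: G) C
| ill_topR G : ILLbot Ax G (Some LTop)
| ill_zeroL G C : ILLbot Ax (LZero :: G) C
| ill_botL : ILLbot Ax [LBot] None
| ill_botR G : ILLbot Ax G None -> ILLbot Ax G (Some LBot)
| ill_tensorR G D A B :
    ILLbot Ax G (Some A) -> ILLbot Ax D (Some B) ->
    ILLbot Ax (G ++ D) (Some (LTensor A B))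
| ill_tensorL G A B C :
    ILLbot Ax (A :: B :: G) C -> ILLbot Ax (LTensor A B :: G) C
| ill_impR G A B :
    ILLbot Ax (A :: G) (Some B) -> ILLbot Ax G (Some (LImp A B))
| ill_impL G D A B C :
    ILLbot Ax G (Some A) -> ILLbot Ax (B :: D) C ->
    ILLbot Ax (LImp A B :: G ++ D) C
| ill_withR G A B :
    ILLbot Ax G (Some A) -> ILLbot Ax G (Some B) -> ILLbot Ax G (Some (LWith A B))
| ill_withL1 G A B C : ILLbot Ax (A :: G) C -> ILLbot Ax (LWith A B :: G) C
| ill_withL2 G A B C : ILLbot Ax (B :: G) C -> ILLbot Ax (LWith A B :: G) C
| ill_plusR1 G A B : ILLbot Ax G (Some A) -> ILLbot Ax G (Some (LPlus A B))
| ill_plusR2 G A B : ILLbot Ax G (Some B) -> ILLbot Ax G (Some (LPlus A B))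
| ill_plusL G A B C :
    ILLbot Ax (A :: G) C -> ILLbot Ax (B :: G) C -> ILLbot Ax (LPlus A B :: G) C
| ill_allR G A :
    ILLbot Ax (map (lsubst shift) G) (Some A) -> ILLbot Ax G (Some (LAll A))
| ill_allL G A t C :
    ILLbot Ax (lsubst (inst t) A :: G) C -> ILLbot Ax (LAll A :: G) C
| ill_exR G A t :
    ILLbot Ax G (Some (lsubst (inst t) A)) -> ILLbot Ax G (Some (LEx A))
| ill_exL G A C :
    ILLbot Ax (A :: map (lsubst shift) G) (option_map (lsubst shift) C) ->
    ILLbot Ax (LEx A :: G) C
| ill_contr G A C :
    ILLbot Ax (LBang A :: LBang A :: G) C -> ILLbot Ax (LBang A :: G) C
| ill_weak G A C : ILLbot Ax G C -> ILLbot Ax (LBang A :: G) C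
| ill_prom G A :
    ILLbot Ax (map LBang G) (Some A) -> ILLbot Ax (map LBang G) (Some (LBang A))
| ill_der G A C : ILLbot Ax (A :: G) C -> ILLbot Ax (LBang A :: G) C.

Inductive PRO {S : signature} : list (lform S) -> option (lform S) -> Prop :=
| PRO_intro A : PRO [A] (Some (LBang A)).

Inductive DNE {S : signature} : list (lform S) -> option (lform S) -> Prop :=
| DNE_intro A : DNE [LNot (LNot A)] (Some A).

Definition CLb {S : signature} : list (lform S) -> option (lform S) -> Prop :=
  ILLbot (fun G C => PRO G C \/ DNE G C).

Definition CLb_provable {S : signature} (A : lform S) : Prop := CLb [] (Some A).

(** ** Classical logic *)

Inductive cform (S : signature) : Type :=
| CAtom (P : psym S) (args : Vector.t (term S) (parity S P))
| CBot
| CAnd (A B : cform S)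
| COr (A B : cform S)
| CImp (A B : cform S)
| CAll (A : cform S)
| CEx (A : cform S).

Arguments CAtom {S} P args.
Arguments CBot {S}.
Arguments CAnd {S} A B.
Arguments COr {S} A B.
Arguments CImp {S} A B.
Arguments CAll {S} A.
Arguments CEx {S} A.

Fixpoint csubst {S : signature} (s : nat -> term S) (A : cform S) : cform S :=
  match A with
  | CAtom P args => CAtom P (Vector.map (subst_term s) args)
  | CBot => CBot
  | CAnd A B => CAnd (csubst s A) (csubst s B)
  | COr A B => COr (csubst s A) (csubst s B)
  | CImp A B => CImp (csubst s A) (csubst s B)
  | CAll A => CAll (csubst (up s) A)
  | CEx A => CEx (csubst (up s) A)
  end.

(* Gentzen-Prawitz natural deduction, with contexts read as sets; [cl_raa] is the
   classical absurdity rule and subsumes ex falso quodlibet. *)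
Inductive CL {S : signature} : list (cform S) -> cform S -> Prop :=
| cl_hyp G A : In A G -> CL G A
| cl_raa G A : CL (CImp A CBot :: G) CBot -> CL G A
| cl_andI G A B : CL G A -> CL G B -> CL G (CAnd A B)
| cl_andE1 G A B : CL G (CAnd A B) -> CL G A
| cl_andE2 G A B : CL G (CAnd A B) -> CL G B
| cl_orI1 G A B : CL G A -> CL G (COr A B)
| cl_orI2 G A B : CL G B -> CL G (COr A B)
| cl_orE G A B C : CL G (COr A B) -> CL (A :: G) C -> CL (B :: G) C -> CL G C
| cl_impI G A B : CL (A :: G) B -> CL G (CImp A B)
| cl_impE G A B : CL G (CImp A B) -> CL G A -> CL G B
| cl_allI G A : CL (map (csubst shift) G) A -> CL G (CAll A)
| cl_allE G A t : CL G (CAll A) -> CL G (csubst (inst t) A)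
| cl_exI G A t : CL G (csubst (inst t) A) -> CL G (CEx A)
| cl_exE G A C :
    CL G (CEx A) -> CL (A :: map (csubst shift) G) (csubst shift C) -> CL G C.

Definition CL_provable {S : signature} (A : cform S) : Prop := CL [] A.

Fixpoint dagger {S : signature} (A : cform S) : lform S :=
  match A with
  | CAtom P args => LAtom P args
  | CBot => LBot
  | CAnd A B => LWith (dagger A) (dagger B)
  | COr A B => LPlus (dagger A) (dagger B)
  | CImp A B => LImp (dagger A) (dagger B)
  | CAll A => LAll (dagger A)
  | CEx A => LEx (dagger A)
  end.

(* Main.v *)
(* Adding the axioms [A |- !A] to ILL with bot makes weakening and contraction
   admissible for all formulas, so that the dagger image of every natural
   deduction rule is derivable, double negation elimination accounting for the
   classical absurdity rule.  Conversely, the translation that erases [!] and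
   identifies the multiplicative and additive connectives maps derivations to
   classical derivations and is a left inverse of dagger. *)
Require Import Defs.
From Stdlib Require Import List Permutation.
Import ListNotations.

(** A cut against the [PRO] axiom from [A] to [LBang A] transfers the structural rules of [!] to
    arbitrary formulas; contraction below uses the same cut. *)
Lemma CLb_weak {S : signature} G (A : lform S) C : CLb G C -> CLb (A :: G) C.
Proof.
  intros H. apply (ill_cut _ [A] G (LBang A)).
  - apply ill_extra. left. constructor.
  - now apply ill_weak.
Qed.

Lemma CLb_contr {S : signature} G (A : lform S) C :
  CLb (A :: A :: G) C -> CLb (A :: G) C.
Proof.
  intros H. apply (ill_cut _ [A] G (LBang A)).
  - apply ill_extra. left. constructor.
  (* Both copies of [LBang A] undergo dereliction, with an exchange bringing the second to the
     front. *)
  - apply ill_contr, ill_der.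
    apply (ill_exch _ (LBang A :: A :: G)); [apply perm_swap|].
    now apply ill_der.
Qed.

Lemma CLb_absorb {S : signature} D (A : lform S) C :
  In A D -> CLb (A :: D) C -> CLb D C.
Proof.
  intros HA H. destruct (in_split _ _ HA) as (D1 & D2 & ->).
  apply (ill_exch _ (A :: D1 ++ D2)); [apply Permutation_middle|].
  apply CLb_contr. eapply ill_exch; [|exact H].
  apply perm_skip, Permutation_sym, Permutation_middle.
Qed.

(** This lets linear antecedents behave as sets, like the contexts of [CL]. Weakening adds all of
    [D]; then each formula of [G] is absorbed into its copy in [D]. *)
Lemma CLb_incl {S : signature} (G D : list (lform S)) C :
  incl G D -> CLb G C -> CLb D C.
Proof.
  intros HGD H.
  assert (HD : CLb (G ++ D) C).
  { apply (ill_exch _ (D ++ G)); [apply Permutation_app_comm|].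
    clear HGD. induction D as [|A D IH]; [exact H|]. apply CLb_weak, IH. }
  clear H. revert HGD HD. induction G as [|A G IH]; intros HGD HD; [exact HD|].
  apply IH.
  - intros B HB. apply HGD. now right.
  - apply (CLb_absorb _ A); [|exact HD].
    apply in_or_app. right. apply HGD. now left.
Qed.

(** Natural deduction shares one context between premises, so the copy duplicated by the
    multiplicative cut is contracted away. *)
Lemma CLb_cut {S : signature} G (A : lform S) C :
  CLb G (Some A) -> CLb (A :: G) C -> CLb G C.
Proof.
  intros HA HC. apply (CLb_incl (G ++ G)); [now apply incl_app|].
  exact (ill_cut _ _ _ _ _ HA HC).
Qed.

Lemma CLb_cut1 {S : signature} G (A : lform S) C :
  CLb G (Some A) -> CLb [A] C -> CLb G C.
Proof.
  intros HA HC. rewrite <- (app_nil_r G). exact (ill_cut _ _ _ _ _ HA HC).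
Qed.

Lemma dagger_subst {S : signature} (A : cform S) :
  forall s, dagger (csubst s A) = lsubst s (dagger A).
Proof. induction A; intros s; simpl; congruence. Qed.

Lemma map_dagger_subst {S : signature} s (G : list (cform S)) :
  map dagger (map (csubst s) G) = map (lsubst s) (map dagger G).
Proof. rewrite !map_map. apply map_ext. intros A. apply dagger_subst. Qed.

Lemma CL_to_CLb {S : signature} G (A : cform S) :
  CL G A -> CLb (map dagger G) (Some (dagger A)).
Proof.
  induction 1 as [G A HA|G A _ IH|G A B _ IHA _ IHB|G A B _ IH|G A B _ IH
    |G A B _ IH|G A B _ IH|G A B C _ IH _ IHA _ IHB|G A B _ IH|G A B _ IH _ IHA
    |G A _ IH|G A t _ IH|G A t _ IH|G A C _ IH _ IHC]; simpl in *.
  - apply (CLb_incl [dagger A]); [|apply ill_id].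
    intros B [<-|[]]. now apply in_map.
  (* The induction hypothesis refutes [LNot (dagger A)]; a cut against [DNE] concludes. *)
  - apply (CLb_cut1 _ (LNot (LNot (dagger A)))); [now apply ill_impR|].
    apply ill_extra. right. constructor.
  - now apply ill_withR.
  - eapply CLb_cut1; [exact IH|]. apply ill_withL1, ill_id.
  - eapply CLb_cut1; [exact IH|]. apply ill_withL2, ill_id.
  - now apply ill_plusR1.
  - now apply ill_plusR2.
  - eapply CLb_cut; [exact IH|]. now apply ill_plusL.
  - now apply ill_impR.
  - eapply CLb_cut; [exact IH|].
    (* The whole context goes to the minor premise, so the other premise is an identity axiom. *)
    rewrite <- (app_nil_r (map dagger G)).
    apply ill_impL; [exact IHA|apply ill_id].
  - apply ill_allR. now rewrite <- map_dagger_subst.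
  - eapply CLb_cut1; [exact IH|]. rewrite dagger_subst. eapply ill_allL, ill_id.
  - apply (ill_exR _ _ _ t). now rewrite <- dagger_subst.
  - eapply CLb_cut; [exact IH|]. apply ill_exL. simpl.
    now rewrite <- map_dagger_subst, <- dagger_subst.
Qed.

Lemma CL_incl {S : signature} (G : list (cform S)) A :
  CL G A -> forall D, incl G D -> CL D A.
Proof.
  assert (Hcons : forall (B : cform S) G D, incl G D -> incl (B :: G) (B :: D)).
  { intros B G' D HGD. apply incl_cons; [now left|now apply incl_tl]. }
  induction 1; intros D HGD.
  - now apply cl_hyp, HGD.
  - apply cl_raa. auto.
  - apply cl_andI; auto.
  - eapply cl_andE1; auto.
  - eapply cl_andE2; auto.
  - apply cl_orI1; auto.
  - apply cl_orI2; auto.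
  - eapply cl_orE; auto.
  - apply cl_impI; auto.
  - eapply cl_impE; auto.
  - apply cl_allI. auto using incl_map.
  - apply cl_allE; auto.
  - eapply cl_exI; auto.
  - eapply cl_exE; auto using incl_map.
Qed.

(** Any [E] containing [G] and [D] is allowed, so that both concatenated and overlapping contexts
    are covered. *)
Lemma CL_cut {S : signature} (G D E : list (cform S)) A C :
  CL G A -> CL (A :: D) C -> incl G E -> incl D E -> CL E C.
Proof.
  intros HA HC HG HD. apply (cl_impE _ A).
  - apply (CL_incl D); [now apply cl_impI|exact HD].
  - now apply (CL_incl G).
Qed.

Lemma CL_replace {S : signature} (G : list (cform S)) A B C :
  CL [A] B -> CL (B :: G) C -> CL (A :: G) C.
Proof.
  intros HB HC. apply (CL_cut [A] G _ B); auto.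
  - now apply incl_cons; [left|apply incl_nil_l].
  - now apply incl_tl.
Qed.

Lemma CL_exfalso {S : signature} (G : list (cform S)) A : CL G CBot -> CL G A.
Proof.
  intros H. apply cl_raa. apply (CL_incl _ _ H). now apply incl_tl.
Qed.

Lemma CL_dne {S : signature} (G : list (cform S)) A :
  CL G (CImp (CImp A CBot) CBot) -> CL G A.
Proof.
  intros H. apply cl_raa, (cl_impE _ (CImp A CBot)).
  - apply (CL_incl _ _ H). now apply incl_tl.
  - apply cl_hyp. now left.
Qed.

(** [CImp CBot CBot] stands for truth, which [cform] does not have as a constant. *)
Fixpoint erase {S : signature} (A : lform S) : cform S :=
  match A with
  | LAtom P args => CAtom P args
  | LOne => CImp CBot CBot
  | LTop => CImp CBot CBot
  | LZero => CBot
  | LBot => CBot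
  | LTensor A B => CAnd (erase A) (erase B)
  | LWith A B => CAnd (erase A) (erase B)
  | LPlus A B => COr (erase A) (erase B)
  | LImp A B => CImp (erase A) (erase B)
  | LAll A => CAll (erase A)
  | LEx A => CEx (erase A)
  | LBang A => erase A
  end.

(** An empty succedent is read as absurdity, which makes both rules for [LBot] trivial. *)
Definition erase_succ {S : signature} (C : option (lform S)) : cform S :=
  match C with
  | Some C => erase C
  | None => CBot
  end.

Lemma erase_subst {S : signature} (A : lform S) :
  forall s, erase (lsubst s A) = csubst s (erase A).
Proof. induction A; intros s; simpl; congruence. Qed.

Lemma erase_succ_subst {S : signature} s (C : option (lform S)) :
  erase_succ (option_map (lsubst s) C) = csubst s (erase_succ C).
Proof. destruct C; [apply erase_subst|reflexivity]. Qed.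

Lemma map_erase_subst {S : signature} s (G : list (lform S)) :
  map erase (map (lsubst s) G) = map (csubst s) (map erase G).
Proof. rewrite !map_map. apply map_ext. intros A. apply erase_subst. Qed.

Lemma erase_dagger {S : signature} (A : cform S) : erase (dagger A) = A.
Proof. induction A; simpl; congruence. Qed.

Lemma CLb_to_CL {S : signature} (G : list (lform S)) C :
  CLb G C -> CL (map erase G) (erase_succ C).
Proof.
  assert (Hid : forall (A : cform S) G, CL (A :: G) A).
  { intros A G'. apply cl_hyp. now left. }
  (* The cases of [PRO], identity, [LBot], promotion and dereliction close at once, being a
     hypothesis or an unchanged premise after erasure. *)
  induction 1 as [G C [[A]|[A]]|G D C HP _ IH|A|G D A C _ IHA _ IHC| |G C _ IH|G|G C
    | |G _ IH|G D A B _ IHA _ IHB|G A B C _ IH|G A B _ IH|G D A B C _ IHA _ IHC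
    |G A B _ IHA _ IHB|G A B C _ IH|G A B C _ IH|G A B _ IH|G A B _ IH
    |G A B C _ IHA _ IHB|G A _ IH|G A t C _ IH|G A t _ IH|G A C _ IH
    |G A C _ IH|G A C _ IH|G A _ IH|G A C _ IH]; simpl in *; auto.
  - apply CL_dne, Hid.
  - apply (CL_incl _ _ IH), incl_map. intros B. now apply Permutation_in.
  - rewrite map_app. eapply CL_cut; [exact IHA|exact IHC| |];
      [now apply incl_appl|now apply incl_appr].
  - apply cl_impI, Hid.
  - apply (CL_incl _ _ IH). now apply incl_tl.
  - apply cl_impI, Hid.
  - apply CL_exfalso, Hid.
  - rewrite map_app. apply cl_andI.
    + apply (CL_incl _ _ IHA). now apply incl_appl.
    + apply (CL_incl _ _ IHB). now apply incl_appr.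
  (* The conjunction stays in the context after [erase B] is projected, since [erase A] must still
     be obtained from it. *)
  - apply (CL_cut [CAnd (erase A) (erase B)]
             (CAnd (erase A) (erase B) :: map erase G) _ (erase B)).
    + eapply cl_andE2, Hid.
    + apply (CL_cut [CAnd (erase A) (erase B)]
               (erase B :: map erase G) _ (erase A)).
      * eapply cl_andE1, Hid.
      * exact IH.
      * intros X [<-|[]]. simpl. auto.
      * intros X [<-|HX]; simpl; auto.
    + intros X [<-|[]]. simpl. auto.
    + apply incl_refl.
  - now apply cl_impI.
  - rewrite map_app.
    apply (CL_cut (CImp (erase A) (erase B) :: map erase G) (map erase D) _ (erase B)).
    + apply (cl_impE _ (erase A)); [apply Hid|].
      apply (CL_incl _ _ IHA). now apply incl_tl.
    + exact IHC.
    + apply incl_cons; [now left|]. apply incl_tl. now apply incl_appl.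
    + apply incl_tl. now apply incl_appr.
  - now apply cl_andI.
  - eapply CL_replace; [|exact IH]. eapply cl_andE1, Hid.
  - eapply CL_replace; [|exact IH]. eapply cl_andE2, Hid.
  - now apply cl_orI1.
  - now apply cl_orI2.
  - eapply cl_orE; [apply Hid| |].
    + apply (CL_incl _ _ IHA). intros X [<-|HX]; simpl; auto.
    + apply (CL_incl _ _ IHB). intros X [<-|HX]; simpl; auto.
  - apply cl_allI. now rewrite <- map_erase_subst.
  - eapply CL_replace; [|exact IH]. rewrite erase_subst. apply cl_allE, Hid.
  - apply (cl_exI _ _ t). now rewrite <- erase_subst.
  (* [cl_exE] keeps the shifted existential formula in the context, so the premise is weakened by
     it. *)
  - eapply cl_exE; [apply Hid|]. rewrite <- erase_succ_subst.
    apply (CL_incl _ _ IH). rewrite map_erase_subst.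
    intros X [<-|HX]; simpl; auto.
  - eapply CL_incl; [exact IH|]. intros X [<-|HX]; simpl; auto.
  - apply (CL_incl _ _ IH). now apply incl_tl.
Qed.

Theorem proposition3 (S : signature) (A : cform S) :
  CL_provable A <-> CLb_provable (dagger A).
Proof.
  split; intros H.
  - exact (CL_to_CLb _ _ H).
  - apply CLb_to_CL in H. simpl in H. now rewrite erase_dagger in H.
Qed.
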